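(* Let $(c_k)_{k\ge0}$ be a real sequence with $c_0=1$ and $A:=\sum_{k=0}^\infty|c_k|<\infty$, such that $\sum_{k=q}^\infty|c_k|\le Ce^{-\lambda q}$ for every $q\ge1$, where $C,\lambda>0$ are constants. Let $(Y_n)_{n\ge1}$ be i.i.d. with $\mathbb{E}[Y_1^2]<\infty$, and assume there is $\delta>0$ with $\mathbb{P}(Y_1<-\delta)>0$ and $\mathbb{P}(Y_1>\delta)>0$. Let $X_n:=\sum_{k=1}^n c_{n-k}Y_k$ and $p_N(x):=\mathbb{P}(\sup_{n=1,\dots,N}X_n\le x)$. Then for every $x\in[0,\delta A)$ there is $c(x)>0$ such that $p_N(x)\precsim\exp(-c(x)\sqrt N)$ as $N\to\infty$. If moreover $\mathbb{E}[\exp(|Y_1|^\alpha)]<\infty$ for some $\alpha>0$, then for every $x\in[0,\delta A)$ there is $c(x)>0$ such that $p_N(x)\precsim\exp(-c(x)N/\log N)$ as $N\to\infty$.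
   Context: $f\precsim g$ means $\limsup_{N\to\infty} f(N)/g(N)<\infty$. *)

(* Defs.v *)
From HB Require Import structures.
From mathcomp Require Import all_boot all_order all_algebra.
From mathcomp Require Import all_classical all_reals all_analysis.
Set Implicit Arguments. Unset Strict Implicit. Unset Printing Implicit Defensive.
Import Order.TTheory GRing.Theory Num.Theory.
Import numFieldNormedType.Exports.
Local Open Scope classical_set_scope.
Local Open Scope ring_scope.

Definition mutually_independent_pos {d : measure_display} {T : measurableType d}
  {R : realType} (P : probability T R) (Y : nat -> T -> R) : Prop :=
  forall (F : seq nat) (B : nat -> set R),
    uniq F -> all (fun i => (0 < i)%N) F ->
    (forall i, measurable (B i)) ->
    fine (P (\bigcap_(i in [set` F]) (Y i @^-1` B i))) =
    \prod_(i <- F) fine (P (Y i @^-1` B i)).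

Definition identically_distributed_pos {d : measure_display} {T : measurableType d}
  {R : realType} (P : probability T R) (Y : nat -> T -> R) : Prop :=
  forall n (B : set R), (0 < n)%N -> measurable B ->
    P (Y n @^-1` B) = P (Y 1%N @^-1` B).

Definition precsim {R : realType} (f g : nat -> R) : Prop :=
  (limn_esup (fun N => (f N / g N)%:E) < +oo)%E.

Definition Xproc {T : Type} {R : realType} (c : nat -> R) (Y : nat -> T -> R)
  (n : nat) (w : T) : R :=
  \sum_(1 <= k < n.+1) c (n - k)%N * Y k w.

Definition pN {d : measure_display} {T : measurableType d} {R : realType}
  (P : probability T R) (c : nat -> R) (Y : nat -> T -> R) (x : R) (N : nat) : R :=
  fine (P [set w | forall n, (1 <= n <= N)%N -> Xproc c Y n w <= x]).

(* Main.v *)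
Require Import Defs.
From HB Require Import structures.
From mathcomp Require Import all_boot all_order all_algebra.
From mathcomp Require Import all_classical all_reals all_analysis.
From mathcomp Require Import measurable_realfun.
From mathcomp Require Import ring lra zify.
Import Order.TTheory GRing.Theory Num.Theory.
Import numFieldNormedType.Exports.
Local Open Scope classical_set_scope.
Local Open Scope ring_scope.
Set Implicit Arguments.
Unset Strict Implicit.
Unset Printing Implicit Defensive.

(** Cut the indices 1..N into blocks of length q.  Within a block ending at n, ask
    that Y_(n-k) have the sign of c_k and modulus larger than delta for k < K, and
    that |Y_(n-k)| <= exp(lambda k / 2) for K <= k < q.  For K large this product
    event has probability at least some p > 0 not depending on q, and it forces
    X_n > x unless some |Y_i| with i <= N exceeds eta * exp(lambda q).  Blocks being
    independent, p_N(x) <= exp(- p (N / q)) + N P(|Y_1| > eta exp(lambda q)).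
    Chebyshev's inequality with q ~ sqrt N, resp. Markov's inequality for
    exp(|Y_1|^alpha) with q ~ (2 / (alpha lambda)) ln N, gives the two bounds. *)

Lemma sum_geometric_le (R : realFieldType) (r : R) (a b : nat) : 0 <= r -> r < 1 ->
  \sum_(a <= k < b) r ^+ k <= r ^+ a / (1 - r).
Proof.
move=> r0 r1; have r1' : 0 < 1 - r by rewrite subr_gt0.
case: (leqP b a) => [ba|/ltnW ab].
  by rewrite big_geq// divr_ge0 ?exprn_ge0// ltW.
rewrite ler_pdivlMr//.
have -> : (\sum_(a <= k < b) r ^+ k) * (1 - r) = r ^+ a - r ^+ b.
  rewrite big_distrl/= (eq_bigr (fun k => r ^+ k - r ^+ k.+1)) => [|k _].
    by rewrite (@telescope_sumr_eq _ _ _ (fun k => - r ^+ k))// => [|k _]; rewrite opprK addrC.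
  by rewrite mulrBr mulr1 exprSr.
by rewrite lerBlDr lerDl exprn_ge0.
Qed.

Lemma prod_onem_ge (R : realDomainType) (I : Type) (s : seq I) (p : I -> R) :
  (forall i, 0 <= p i <= 1) -> 1 - \sum_(i <- s) p i <= \prod_(i <- s) (1 - p i).
Proof.
move=> p01; elim: s => [|i s IH]; first by rewrite !big_nil subr0.
rewrite !big_cons; have /andP[pi0 pi1] := p01 i.
have s0 : 0 <= \sum_(j <- s) p j by apply: sumr_ge0 => j _; case/andP: (p01 j).
have : (1 - p i) * (1 - \sum_(j <- s) p j) <= (1 - p i) * \prod_(j <- s) (1 - p j).
  by rewrite ler_wpM2l// subr_ge0.
apply: le_trans; nra.
Qed.

Lemma precsim_bounded (R : realType) (f g : nat -> R) (B : R) (N0 : nat) :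
  (forall N, 0 < g N) -> (forall N, (N0 <= N)%N -> f N <= B * g N) -> precsim f g.
Proof.
move=> g0 fg; rewrite /precsim /limn_esup /limf_esup.
apply: (@le_lt_trans _ _ B%:E); last exact: ltry.
apply: ge_ereal_inf; exists (ereal_sup [set ((f x / g x)%:E)%E | x in [set N | (N0 <= N)%N]]).
  by exists [set N | (N0 <= N)%N] => //; exact: nbhs_infty_ge.
apply: ge_ereal_sup => _ [N /= N0N <-].
by rewrite lee_fin ler_pdivrMr// fg.
Qed.

Definition rect {T : Type} {R : realType} (Y : nat -> T -> R) (B : nat -> set R)
  (F : seq nat) : set T := \bigcap_(i in [set` F]) (Y i @^-1` B i).

Definition block (q j : nat) : seq nat := iota (j * q).+1 q.

Definition avoid {T : Type} {R : realType} (Y : nat -> T -> R) (B : nat -> set R)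
  (q m : nat) : set T := [set w | forall j, (j < m)%N -> ~ rect Y B (block q j) w].

Lemma measurable_rect (d : measure_display) (T : measurableType d) (R : realType)
  (Y : nat -> {mfun T >-> R}) (B : nat -> set R) (F : seq nat) :
  (forall i, measurable (B i)) -> measurable (rect (fun n => Y n : T -> R) B F).
Proof.
by move=> mB; apply: bigcap_measurableType => i _; exact: measurable_funPTI.
Qed.

Lemma measurable_avoid (d : measure_display) (T : measurableType d) (R : realType)
  (Y : nat -> {mfun T >-> R}) (B : nat -> set R) (q m : nat) :
  (forall i, measurable (B i)) -> measurable (avoid (fun n => Y n : T -> R) B q m).
Proof.
move=> mB; rewrite (_ : avoid _ _ _ _ =
  \bigcap_(j in [set j | (j < m)%N]) ~` rect (fun n => Y n : T -> R) B (block q j)) //.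
by apply: bigcap_measurableType => j _; apply/measurableC/measurable_rect.
Qed.

(* The rectangle F beyond the first m blocks is there for the induction on m: the event
   of block m is absorbed into F. *)
Lemma prob_avoid_rect (d : measure_display) (T : measurableType d) (R : realType)
  (P : probability T R) (Y : nat -> {mfun T >-> R}) (B : nat -> set R) (q : nat) :
  mutually_independent_pos P (fun n => Y n : T -> R) ->
  (forall i, measurable (B i)) ->
  forall m F, uniq F -> all (fun i => (m * q < i)%N) F ->
  fine (P (avoid (fun n => Y n : T -> R) B q m `&` rect (fun n => Y n : T -> R) B F)) =
  \prod_(j < m) (1 - \prod_(i <- block q j) fine (P (Y i @^-1` B i))) *
  \prod_(i <- F) fine (P (Y i @^-1` B i)).
Proof.
move=> indep mB; elim=> [|m IH] F uF aF.
  rewrite big_ord0 mul1r (_ : avoid _ _ _ _ = setT); last first.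
    by apply/seteqP; split.
  by rewrite setTI; apply: indep => //; apply: sub_all aF => i; rewrite mul0n.
set Y' := (fun n => Y n : T -> R).
have mA : measurable (avoid Y' B q m `&` rect Y' B F).
  by apply: measurableI; [exact: measurable_avoid|exact: measurable_rect].
have mR : measurable (rect Y' B (block q m)) by exact: measurable_rect.
have -> : avoid Y' B q m.+1 `&` rect Y' B F =
    (avoid Y' B q m `&` rect Y' B F) `\` rect Y' B (block q m).
  apply/seteqP; split=> w /=.
    by move=> [av rw]; split; [split=> // j jm; apply: av; rewrite ltnS ltnW|exact: av].
  move=> [[av rw] nw]; split=> // j; rewrite ltnS leq_eqVlt => /orP[/eqP -> //|]; exact: av.
rewrite measureD//; last by rewrite ltey_eq fin_num_measure.
rewrite fineB ?fin_num_measure//; last exact: measurableI.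
have -> : avoid Y' B q m `&` rect Y' B F `&` rect Y' B (block q m) =
    avoid Y' B q m `&` rect Y' B (block q m ++ F).
  apply/seteqP; split=> w /=.
    by move=> [[av rw] bw]; split=> // i /=; rewrite mem_cat => /orP[]; [exact: bw|exact: rw].
  by move=> [av rw]; split; [split=> // i iF; apply: rw; rewrite /= mem_cat iF orbT|
    move=> i iF; apply: rw; rewrite /= mem_cat iF].
have aF' : all (fun i => (m * q < i)%N) F.
  by apply: sub_all aF => i; apply: leq_ltn_trans; rewrite leq_mul2r leqnSn orbT.
rewrite !IH//; last 2 first.
  rewrite cat_uniq iota_uniq uF andbT/=; apply/hasPn => i iF.
  move/allP: aF => /(_ _ iF); rewrite mem_iota mulSn; lia.
  rewrite all_cat aF' andbT; apply/allP => i; rewrite mem_iota; lia.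
by rewrite big_ord_recr/= big_cat/=; ring.
Qed.

Lemma Xproc_ge (T : Type) (R : realType) (c : nat -> R) (Y : nat -> T -> R) (w : T)
  (delta M : R) (L : nat -> R) (K q n : nat) : (K <= q <= n)%N ->
  (forall k, (k < K)%N -> delta * `|c k| <= c k * Y (n - k)%N w) ->
  (forall k, (K <= k < q)%N -> `|Y (n - k)%N w| <= L k) ->
  (forall k, (q <= k < n)%N -> `|Y (n - k)%N w| <= M) ->
  delta * (\sum_(0 <= k < K) `|c k|) - \sum_(K <= k < q) `|c k| * L k
    - (\sum_(q <= k < n) `|c k|) * M <= Xproc c Y n w.
Proof.
move=> /andP[Kq qn] h1 h2 h3.
have -> : Xproc c Y n w = \sum_(0 <= k < n) c k * Y (n - k)%N w.
  rewrite /Xproc big_add1/= big_nat_rev/=; apply: eq_big_nat => k kn.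
  by congr (c _ * Y _ w); lia.
rewrite (@big_cat_nat _ _ _ q 0 n)//= (@big_cat_nat _ _ _ K 0 q)//= big_distrr/= big_distrl/=.
rewrite -!sumrN; apply: lerD; first apply: lerD.
- by apply: ler_sum_nat => k /= kK; exact: h1.
- apply: ler_sum_nat => k /= kK; rewrite lerNl.
  by apply: le_trans (ler_norm _) _; rewrite normrN normrM ler_wpM2l// h2.
- apply: ler_sum_nat => k /= kK; rewrite lerNl.
  by apply: le_trans (ler_norm _) _; rewrite normrN normrM ler_wpM2l// h3.
Qed.

Definition target {R : realType} (c : nat -> R) (delta : R) (L : nat -> R) (K k : nat) :
    set R :=
  if (k < K)%N then
    if 0 <= c k then [set y | delta < y] else [set y | y < - delta]
  else [set y | `|y| <= L k].

Lemma measurable_target (R : realType) (c : nat -> R) (delta : R) (L : nat -> R)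
  (K k : nat) : measurable (target c delta L K k).
Proof.
rewrite /target; case: ifP => _; [case: ifP => _|].
- by rewrite -set_itvoy.
- by rewrite -set_itvNyo.
- rewrite (_ : [set _ | _] = `[- L k, L k]%classic); first exact: measurable_itv.
  by apply/seteqP; split=> y /=; rewrite in_itv/= ler_norml.
Qed.

Lemma target_mul_ge (R : realType) (c : nat -> R) (delta : R) (L : nat -> R) (K k : nat)
  (y : R) : (k < K)%N -> target c delta L K k y -> delta * `|c k| <= c k * y.
Proof.
move=> kK; rewrite /target kK; case: (leP 0 (c k)) => /= c0 yd.
  by rewrite ger0_norm// mulrC ler_wpM2l// ltW.
by rewrite ltr0_norm// mulrN -mulNr mulrC ler_wnM2l ?ltW.
Qed.

Lemma prod_target_ge (d : measure_display) (T : measurableType d) (R : realType)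
  (P : probability T R) (c : nat -> R) (Z : {mfun T >-> R}) (delta p : R) (L : nat -> R)
  (K q : nat) : (K <= q)%N -> 0 <= p ->
  p <= fine (P [set w | (Z w < - delta)%R]) ->
  p <= fine (P [set w | (Z w > delta)%R]) ->
  \sum_(K <= k < q) fine (P [set w | (L k < `|Z w|)%R]) <= 2^-1 ->
  p ^+ K / 2 <= \prod_(0 <= k < q) fine (P (Z @^-1` target c delta L K k)).
Proof.
move=> Kq p0 pneg ppos hs; rewrite (@big_cat_nat _ _ _ K 0 q)//=.
have mL k : measurable [set w | (L k < `|Z w|)%R].
  rewrite (_ : [set _ | _] = ~` (Z @^-1` target c delta L 0 k)).
    by apply: measurableC; apply: measurable_funPTI; exact: measurable_target.
  by apply/seteqP; split=> w /=; rewrite /target/= ltNge => /negP.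
apply: ler_pM; rewrite ?exprn_ge0 ?invr_ge0 ?ler0n//.
- rewrite -[K in X in X <= _]subn0 -prodr_const_nat; rewrite big_nat [leRHS]big_nat; apply: ler_prod => k kK.
  by rewrite p0/= /target; case/andP: kK => _ ->; case: ifP => _.
- apply: (@le_trans _ _ (\prod_(K <= k < q) (1 - fine (P [set w | (L k < `|Z w|)%R])))).
    apply: le_trans (prod_onem_ge _ _); first by lra.
    move=> k; rewrite fine_ge0//= -[leRHS]fine1//; apply: fine_le => //.
      exact: fin_num_measure.
    exact: probability_le1.
  rewrite big_nat [leRHS]big_nat; apply: ler_prod => k /andP[Kk kq]; apply/andP; split.
    rewrite subr_ge0 -[leRHS]fine1//; apply: fine_le => //.
      exact: fin_num_measure.
    exact: probability_le1.
  rewrite (_ : Z @^-1` _ = ~` [set w | (L k < `|Z w|)%R]).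
    by rewrite probability_setC// fineB ?fin_num_measure.
  rewrite /target ltnNge Kk/=.
  by apply/seteqP; split=> w /=; rewrite leNgt => /negP.
Qed.

Lemma pN_le (d : measure_display) (T : measurableType d) (R : realType)
  (P : probability T R) (c : nat -> R) (Y : nat -> {mfun T >-> R}) (x delta M : R)
  (L : nat -> R) (K q N : nat) :
  mutually_independent_pos P (fun n => Y n : T -> R) ->
  identically_distributed_pos P (fun n => Y n : T -> R) ->
  (K <= q)%N -> (0 < q)%N ->
  (forall n, (q <= n)%N ->
    x < delta * (\sum_(0 <= k < K) `|c k|) - \sum_(K <= k < q) `|c k| * L k
        - (\sum_(q <= k < n) `|c k|) * M) ->
  pN P c (fun n => Y n : T -> R) x N <=
  (1 - \prod_(0 <= k < q) fine (P (Y 1%N @^-1` target c delta L K k))) ^+ (N %/ q)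
  + N%:R * fine (P [set w | (M < `|Y 1%N w|)%R]).
Proof.
move=> indep ident Kq q0 hx.
pose Y' := fun n => Y n : T -> R.
(* In block j the position i sits k = (j+1)q - i steps before the end of the block. *)
pose B i := target c delta L K ((i.-1 %/ q).+1 * q - i)%N.
have mB i : measurable (B i) by exact: measurable_target.
have mM : measurable [set y : R | M < `|y|].
  rewrite (_ : [set _ | _] = ~` `[- M, M]%classic); first exact: measurableC.
  by apply/seteqP; split=> y /=; rewrite in_itv/= -ler_norml ltNge => /negP.
pose G i := if i is i'.+1 then Y i @^-1` [set y : R | M < `|y|] else avoid Y' B q (N %/ q).
have mG i : measurable (G i).
  by case: i => [|i]; [exact: measurable_avoid|exact: measurable_funPTI].
have mX n : measurable_fun setT (Xproc c Y' n).
  apply: measurable_sum => k; apply: measurable_funM => //.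
set E := [set w | forall n, (1 <= n <= N)%N -> Xproc c Y' n w <= x].
have mE : measurable E.
  rewrite (_ : E = \bigcap_(n in [set n | (1 <= n <= N)%N]) (Xproc c Y' n @^-1` `]-oo, x])).
    apply: bigcap_measurableType => n _; rewrite -[_ @^-1` _]setTI; exact: mX.
  by apply/seteqP; split=> w h n /h /=; rewrite in_itv.
have sub : E `<=` \big[setU/set0]_(i < N.+1) G i.
  move=> w Ew; rewrite -bigcup_mkord.
  have [[i [iN i0 Mi]]|small] := pselect (exists i, [/\ (i <= N)%N, (0 < i)%N & M < `|Y i w|]).
    by exists i => //; case: i i0 Mi {iN}.
  exists 0%N => // j jN rw.
  have jqN : (j.+1 * q <= N)%N.
    by apply: leq_trans (leq_trunc_div N q); rewrite leq_mul2r jN orbT.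
  have qj : (q <= j.+1 * q)%N by rewrite mulSn leq_addr.
  have := Ew (j.+1 * q)%N; rewrite jqN (leq_trans q0 qj)/= => /(_ isT).
  apply/negP; rewrite -ltNge; apply: lt_le_trans (hx _ qj) _.
  have tk k : (k < q)%N -> target c delta L K k (Y (j.+1 * q - k)%N w).
    move=> kq; have ib : (j.+1 * q - k)%N \in block q j.
      by rewrite mem_iota; apply/andP; split; rewrite mulSn; lia.
    have := rw _ ib; rewrite /= /B.
    have -> : ((j.+1 * q - k).-1 %/ q = j)%N.
      rewrite (_ : (j.+1 * q - k).-1 = j * q + (q - k).-1)%N; last by rewrite mulSn; lia.
      by rewrite divnMDl// divn_small ?addn0//; lia.
    by rewrite subKn// mulSn; lia.
  apply: Xproc_ge; first by rewrite Kq.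
  - by move=> k kK; apply: target_mul_ge (tk _ _) => //; exact: leq_trans Kq.
  - by move=> k /andP[Kk kq]; have := tk _ kq; rewrite /target ltnNge Kk.
  - move=> k /andP[qk kn]; rewrite leNgt; apply/negP => Mk; apply: small.
    by exists (j.+1 * q - k)%N; split=> //; lia.
have := content_subadditive P (fun k _ => mG k) mE sub.
rewrite big_ord_recl => /= le1.
have {le1} : fine (P E) <= fine (P (G 0%N)) + \sum_(i < N) fine (P (G i.+1)).
  rewrite -lee_fin EFinD fineK ?fin_num_measure// fineK ?fin_num_measure// -sumEFin.
  apply: le_trans le1 _; rewrite leeD2l//; apply: lee_sum => i _.
  by rewrite fineK ?fin_num_measure.
move=> /le_trans; apply; apply: lerD.
- have := @prob_avoid_rect _ _ _ P Y B q indep mB (N %/ q) [::] isT isT.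
  rewrite big_nil mulr1 (_ : rect _ _ _ = setT); last by apply/seteqP; split.
  rewrite setIT => ->; rewrite -[in leRHS](card_ord (N %/ q)) -prodr_const.
  rewrite le_eqVlt; apply/orP; left; apply/eqP; apply: eq_bigr => j _; congr (1 - _).
  have -> : block q j = index_iota (0 + (j * q).+1) (q + (j * q).+1).
    by rewrite /index_iota/= addnK.
  rewrite big_addn addnK big_nat_rev/=; apply: eq_big_nat => k /andP[_ kq].
  have i0 : (0 < 0 + q - k.+1 + (j * q).+1)%N by lia.
  rewrite (ident _ _ i0 (mB _)); congr (fine (P (_ @^-1` target c delta L K _))).
  rewrite addnS/= (divnDr _ (dvdn_mull _ _))// mulnK// divn_small; last by lia.
  by rewrite add0n mulSn; lia.
- rewrite (eq_bigr (fun=> fine (P (G 1%N)))) => [|i _]; last by rewrite /G (ident i.+1).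
  by rewrite sumr_const card_ord mulr_natl.
Qed.

Lemma prob_norm_gt_le (d : measure_display) (T : measurableType d) (R : realType)
  (P : probability T R) (Z : {mfun T >-> R}) (f : R -> R) (M : R) :
  0 < M -> measurable_fun setT f -> (forall r, 0 <= r -> 0 <= f r) ->
  {in Num.nneg &, {homo f : x y / x <= y}} -> 0 < f M ->
  (\int[P]_w (f `|Z w|)%:E < +oo)%E ->
  fine (P [set w | (M < `|Z w|)%R]) <= fine (\int[P]_w (f `|Z w|)%:E) / f M.
Proof.
move=> M0 mf f0 fmono fM0 ifin; rewrite ler_pdivlMr// mulrC.
have mn : measurable_fun setT (fun w => `|Z w|) by exact: measurableT_comp.
have mZ : measurable [set w | (M <= `|Z w|)%R].
  by rewrite -[[set _ | _]]setTI; exact: measurable_fun_le.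
have mZ' : measurable [set w | (M < `|Z w|)%R].
  rewrite (_ : [set _ | _] = setT `&` (fun w => `|Z w|) @^-1` `]M, +oo[); first exact: mn.
  by rewrite setTI; apply/seteqP; split=> w /=; rewrite in_itv/= andbT.
have := @markov _ _ _ P Z f M M0 mf f0 fmono; rewrite unlock /=.
have -> : [set w | (M%:E <= `|(Z w)%:E|)%E] = [set w | (M <= `|Z w|)%R].
  by apply/seteqP; split=> w /=; rewrite lee_fin.
move=> mk; rewrite -lee_fin EFinM !fineK ?fin_num_measure//; last first.
  by rewrite ge0_fin_numE//; apply: integral_ge0 => w _; rewrite lee_fin f0.
apply: le_trans mk; apply: lee_wpmul2l; first by rewrite lee_fin ltW.
by apply: le_measure; rewrite ?inE// => w /=; exact: ltW.
Qed.

Lemma prob_norm_gt_sqr (d : measure_display) (T : measurableType d) (R : realType)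
  (P : probability T R) (Z : {mfun T >-> R}) (M : R) :
  (\int[P]_w (((Z w) ^+ 2)%R)%:E < +oo)%E -> 0 < M ->
  fine (P [set w | (M < `|Z w|)%R]) <= fine (\int[P]_w (((Z w) ^+ 2)%R)%:E) / M ^+ 2.
Proof.
have eqV : (\int[P]_w ((`|Z w| ^+ 2)%R)%:E)%E = (\int[P]_w (((Z w) ^+ 2)%R)%:E)%E.
  by apply: eq_integral => w _; rewrite real_normK// num_real.
move=> Zfin M0; have := @prob_norm_gt_le _ _ _ P Z (fun y => y ^+ 2) M M0; rewrite eqV.
apply=> //.
- by move=> r _; rewrite sqr_ge0.
- by move=> u v; rewrite !nnegrE => u0 v0 uv; rewrite ler_pXn2r.
- by rewrite exprn_gt0.
Qed.

Lemma prob_norm_gt_expR (d : measure_display) (T : measurableType d) (R : realType)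
  (P : probability T R) (Z : {mfun T >-> R}) (alpha M : R) : 0 < alpha ->
  (\int[P]_w ((expR (`|Z w| `^ alpha))%R)%:E < +oo)%E -> 0 < M ->
  fine (P [set w | (M < `|Z w|)%R]) <=
  fine (\int[P]_w ((expR (`|Z w| `^ alpha))%R)%:E) / expR (M `^ alpha).
Proof.
move=> a0 Zfin M0.
apply: (@prob_norm_gt_le _ _ _ P Z (fun y => expR (y `^ alpha)) M M0) => //.
- by apply: measurableT_comp => //; exact: measurable_powR.
- by move=> u v u0 v0 uv; rewrite ler_expR ge0_ler_powR// ltW.
Qed.

Lemma expRN_mul_small (R : realType) (mu H : R) : 0 < mu -> 0 <= H ->
  exists K : nat, (0 < K)%N /\ expR (- mu * K%:R) * H <= 1.
Proof.
move=> mu0 H0; exists (Num.truncn (H / mu)).+1; split=> //.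
set K := _.+1; have hK : H / mu < K%:R by exact: truncnS_gt.
rewrite mulNr expRN mulrC ler_pdivrMr ?expR_gt0// mul1r.
apply: le_trans (expR_ge1Dx _); move: hK; rewrite ltr_pdivrMr// mulrC => hK.
by rewrite (le_trans (ltW hK))// lerDr.
Qed.

Lemma pN_le_block (d : measure_display) (T : measurableType d) (R : realType)
  (P : probability T R) (c : nat -> R) (C lambda delta x : R)
  (Y : nat -> {mfun T >-> R}) :
  (\sum_(k <oo) (`|c k|)%:E < +oo)%E ->
  0 < C -> 0 < lambda ->
  (forall q : nat, (1 <= q)%N ->
     (\sum_(q <= k <oo) (`|c k|)%:E <= (C * expR (- lambda * q%:R))%:E)%E) ->
  mutually_independent_pos P (fun n => Y n : T -> R) ->
  identically_distributed_pos P (fun n => Y n : T -> R) ->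
  (\int[P]_w (((Y 1%N w) ^+ 2)%R)%:E < +oo)%E ->
  0 < delta ->
  (0 < P [set w | (Y 1%N w < - delta)%R])%E ->
  (0 < P [set w | (Y 1%N w > delta)%R])%E ->
  x < delta * fine (\sum_(k <oo) (`|c k|)%:E)%E ->
  exists K p eta, [/\ 0 < p, 0 < eta & forall q N, (K <= q)%N -> (0 < q)%N ->
    pN P c (fun n => Y n : T -> R) x N <=
    expR (- p * (N %/ q)%:R) +
    N%:R * fine (P [set w | (eta * expR (lambda * q%:R) < `|Y 1%N w|)%R])].
Proof.
move=> cfin C0 lambda0 ctail indep ident Y2fin delta0 Pneg Ppos.
set A := fine _ => xA.
have tail a b : (0 < a)%N -> \sum_(a <= k < b) `|c k| <= C * expR (- lambda * a%:R).
  move=> a0; rewrite -lee_fin -sumEFin; apply: le_trans (ctail _ a0).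
  exact: nneseries_lim_ge.
have Ahead a : (0 < a)%N -> A <= \sum_(0 <= k < a) `|c k| + C * expR (- lambda * a%:R).
  move=> a0; rewrite -lee_fin fineK; last first.
    by rewrite ge0_fin_numE//; apply: nneseries_ge0 => k _ _; rewrite lee_fin.
  rewrite (nneseries_split 0 a) => [|k _]; last by rewrite lee_fin.
  by rewrite add0n EFinD -sumEFin; apply: leeD2l; exact: ctail.
have c_le k : (0 < k)%N -> `|c k| <= C * expR (- lambda * k%:R).
  by move=> k0; have := tail k k.+1 k0; rewrite big_nat1.
pose V := fine (\int[P]_w (((Y 1%N w) ^+ 2)%R)%:E).
have V0 : 0 <= V by rewrite fine_ge0//; apply: integral_ge0 => w _; rewrite lee_fin sqr_ge0.
have cheb M : 0 < M -> fine (P [set w | (M < `|Y 1%N w|)%R]) <= V / M ^+ 2.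
  exact: prob_norm_gt_sqr.
pose mu := lambda / 2; have mu0 : 0 < mu by rewrite divr_gt0.
pose r := expR (- mu); have r0 : 0 < r by exact: expR_gt0.
have r1 : r < 1 by rewrite expR_lt1 oppr_lt0.
have rE k : expR (- mu * k%:R) = r ^+ k by rewrite expRM_natr.
have r2E k : expR (- lambda * k%:R) = r ^+ k * r ^+ k.
  by rewrite -!rE -expRD; congr expR; rewrite /mu; lra.
pose L k := expR (mu * k%:R).
have rL k : r ^+ k * L k = 1 by rewrite -rE /L mulNr expRN mulVf// gt_eqF// expR_gt0.
have rk1 k : r ^+ k <= 1 by rewrite exprn_ile1// ltW.
have rk0 k : 0 <= r ^+ k by rewrite exprn_ge0// ltW.
pose g := delta * A - x; have g0 : 0 < g by rewrite subr_gt0.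
have r1' : 0 < 1 - r by rewrite subr_gt0.
pose H1 := delta * C * 4 / g; pose H2 := C / (1 - r) * 4 / g; pose H3 := V / (1 - r) * 2.
have d0 := ltW delta0; have C0' := ltW C0; have g0' := ltW g0; have r1'' := ltW r1'.
have H1_0 : 0 <= H1 by rewrite /H1 !(mulr_ge0, invr_ge0).
have H2_0 : 0 <= H2 by rewrite /H2 !(mulr_ge0, invr_ge0).
have H3_0 : 0 <= H3 by rewrite /H3 !(mulr_ge0, invr_ge0).
have [K [K0]] : exists K : nat, (0 < K)%N /\ expR (- mu * K%:R) * (H1 + H2 + H3) <= 1.
  by apply: expRN_mul_small => //; rewrite !addr_ge0.
rewrite rE => HK.
have hK1 : delta * C * r ^+ K <= g / 4.
  have : r ^+ K * H1 <= 1.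
    apply: le_trans HK; rewrite ler_wpM2l//; lra.
  by rewrite /H1 mulrA ler_pdivrMr// mul1r; lra.
have hK2 : C * (r ^+ K / (1 - r)) <= g / 4.
  have : r ^+ K * H2 <= 1.
    apply: le_trans HK; rewrite ler_wpM2l//; lra.
  rewrite /H2 mulrA ler_pdivrMr// mul1r.
  rewrite (_ : _ * (_ * 4) = C * (r ^+ K / (1 - r)) * 4); first lra.
  by ring.
have hK3 : V * (r ^+ K / (1 - r)) <= 2^-1.
  have : r ^+ K * H3 <= 1.
    apply: le_trans HK; rewrite ler_wpM2l//; lra.
  rewrite /H3 (_ : _ * (_ * 2) = V * (r ^+ K / (1 - r)) * 2); first lra.
  by ring.
pose p0 := Num.min (fine (P [set w | (Y 1%N w < - delta)%R]))
                   (fine (P [set w | (Y 1%N w > delta)%R])).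
have mneg : measurable [set w | (Y 1%N w < - delta)%R].
  by rewrite -[[set _ | _]]/(Y 1%N @^-1` [set y | y < - delta]); apply: measurable_funPTI;
    rewrite -set_itvNyo.
have mpos : measurable [set w | (Y 1%N w > delta)%R].
  by rewrite -[[set _ | _]]/(Y 1%N @^-1` [set y | y > delta]); apply: measurable_funPTI;
    rewrite -set_itvoy.
have p0_gt0 : 0 < p0.
  by rewrite lt_min !fine_gt0// ?Pneg ?Ppos/= ltey_eq fin_num_measure.
exists K, (p0 ^+ K / 2), (g / (4 * C)); split.
- by rewrite divr_gt0// exprn_gt0.
- by rewrite divr_gt0// mulr_gt0.
move=> q N Kq q0.
have Lpos k : 0 < L k by exact: expR_gt0.
have prodge : p0 ^+ K / 2 <=
    \prod_(0 <= k < q) fine (P (Y 1%N @^-1` target c delta L K k)).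
  apply: prod_target_ge => //; rewrite ?ge_min ?lexx ?orbT//; first exact: ltW.
  apply: le_trans hK3; apply: le_trans (_ : V * \sum_(K <= k < q) r ^+ k <= _).
    rewrite big_distrr/=; apply: ler_sum_nat => k _.
    apply: le_trans (cheb _ (Lpos k)) _; rewrite ler_wpM2l//.
    have -> : (L k ^+ 2)^-1 = r ^+ k * r ^+ k.
      apply: (@mulfI _ (L k ^+ 2)); first by rewrite gt_eqF// exprn_gt0.
      by rewrite divff ?gt_eqF ?exprn_gt0//; move: (rL k); nra.
    by rewrite ler_piMr.
  by rewrite ler_wpM2l// sum_geometric_le// ltW.
have prodle : \prod_(0 <= k < q) fine (P (Y 1%N @^-1` target c delta L K k)) <= 1.
  apply: prodr_ile1 => k _; rewrite fine_ge0//=.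
  have mt : measurable (Y 1%N @^-1` target c delta L K k).
    by apply: measurable_funPTI; exact: measurable_target.
  by rewrite -[leRHS]fine1 fine_le ?fin_num_measure ?probability_le1.
have := @pN_le _ _ _ P c Y x delta (g / (4 * C) * expR (lambda * q%:R)) L K q N
  indep ident Kq q0.
set G := fine _; move=> h; apply: le_trans (h _) _ => {h} [n qn|].
  have h1 : delta * A - g / 4 <= delta * \sum_(0 <= k < K) `|c k|.
    have := Ahead _ K0; rewrite -(ler_pM2l delta0) mulrDr.
    have : delta * (C * expR (- lambda * K%:R)) <= delta * C * r ^+ K.
      by rewrite r2E !mulrA ler_piMr// !mulr_ge0// ltW.
    lra.
  have h2 : \sum_(K <= k < q) `|c k| * L k <= g / 4.
    apply: le_trans hK2; apply: le_trans (_ : C * \sum_(K <= k < q) r ^+ k <= _).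
      rewrite big_distrr/=; apply: ler_sum_nat => k /andP[Kk _].
      apply: (@le_trans _ _ (C * (r ^+ k * r ^+ k) * L k)).
        by rewrite -r2E ler_wpM2r ?c_le ?(leq_trans K0)// ltW.
      by rewrite -!mulrA rL mulr1.
    by rewrite ler_wpM2l// sum_geometric_le// ltW.
  have h3 : (\sum_(q <= k < n) `|c k|) * (g / (4 * C) * expR (lambda * q%:R)) <= g / 4.
    have e0 : 0 < g / (4 * C) * expR (lambda * q%:R).
      by rewrite mulr_gt0 ?expR_gt0// divr_gt0// mulr_gt0.
    apply: le_trans (_ : C * expR (- lambda * q%:R) * (g / (4 * C) * expR (lambda * q%:R)) <= _).
      by rewrite ler_wpM2r ?tail// ltW.
    rewrite mulNr expRN le_eqVlt; apply/orP; left; apply/eqP; field.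
    by rewrite !gt_eqF ?expR_gt0.
  have : x = delta * A - g by rewrite /g; lra.
  lra.
apply: lerD => //; rewrite expRM_natr lerXn2r ?nnegrE ?expR_ge0 ?subr_ge0//.
by apply: le_trans (expR_ge1Dx _); rewrite lerD2l lerN2.
Qed.

Lemma divn_add1_gt (R : realFieldType) (N q : nat) (u : R) : (0 < q)%N -> q%:R <= u ->
  N%:R / u < (N %/ q)%:R + 1.
Proof.
move=> q0 qu; have u0 : 0 < u by apply: lt_le_trans qu; rewrite ltr0n.
rewrite ltr_pdivrMr// natr1.
have : (N < (N %/ q).+1 * q)%N by exact: ltn_ceil.
rewrite -(ltr_nat R) natrM => /lt_le_trans; apply.
by rewrite ler_wpM2l.
Qed.

Lemma precsim_sqrt (R : realType) (f tau : nat -> R) (K : nat) (p lambda eta V : R) :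
  0 < p -> 0 < eta -> 0 < lambda -> 0 <= V ->
  (forall q N, (K <= q)%N -> (0 < q)%N ->
    f N <= expR (- p * (N %/ q)%:R) + N%:R * tau q) ->
  (forall q, tau q <= V / (eta * expR (lambda * q%:R)) ^+ 2) ->
  exists cx, 0 < cx /\ precsim f (fun N => expR (- cx * Num.sqrt N%:R)).
Proof.
move=> p0 eta0 lambda0 V0 hf htau; exists (Num.min p lambda); rewrite lt_min p0 lambda0.
split=> //; set cx := Num.min _ _.
have cxp : cx <= p by rewrite ge_min lexx.
have cxl : cx <= lambda by rewrite ge_min lexx orbT.
apply: (@precsim_bounded _ _ _ (expR (2 * p) + 2 * V / (lambda ^+ 2 * eta ^+ 2)) (K ^ 2)).
  by move=> N; exact: expR_gt0.
move=> N KN; set s := Num.sqrt _.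
have s0 : 0 <= s by exact: sqrtr_ge0.
have sE : s ^+ 2 = N%:R by rewrite sqr_sqrtr// ler0n.
set q := (Num.truncn s).+1.
have sq : s < q%:R by exact: truncnS_gt.
have qs : q%:R <= s + 1 by rewrite -natr1 lerD2r truncn_le.
have Kq : (K <= q)%N.
  rewrite -(ler_nat R); apply: le_trans (ltW sq).
  by rewrite -(@ler_pXn2r _ 2)// ?nnegrE// sE -natrX ler_nat.
apply: le_trans (hf q N Kq isT) _; rewrite mulrDl; apply: lerD.
  have := divn_add1_gt N (isT : (0 < q)%N) qs.
  have hs : s - 1 <= N%:R / (s + 1).
    by rewrite ler_pdivlMr ?ltr_wpDl// -sE; nra.
  set m := (_ %/ _)%N => hm; have {}hm : s - 2 <= m%:R by lra.
  rewrite -expRD ler_expR; nra.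
apply: (@le_trans _ _ (N%:R * (V / (eta * expR (lambda * s)) ^+ 2))).
  rewrite ler_wpM2l//; apply: le_trans (htau q) _; rewrite ler_wpM2l// lef_pV2 ?posrE;
    rewrite ?exprn_gt0 ?mulr_gt0 ?expR_gt0//.
  rewrite ler_pXn2r ?nnegrE ?mulr_ge0 ?expR_ge0 ?(ltW eta0)//.
  by rewrite ler_wpM2l ?(ltW eta0)// ler_expR ler_wpM2l ?(ltW lambda0, ltW sq).
have e0 : 0 < expR (lambda * s) by exact: expR_gt0.
have hN : N%:R <= 2 / lambda ^+ 2 * expR (lambda * s).
  have := @expR_ge1Dxn _ (lambda * s) 1 (mulr_ge0 (ltW lambda0) s0).
  rewrite exprMn sE; set E := expR _; set y := _ * N%:R ; rewrite (_ : 2`!%N = 2%N)// => hE.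
  by rewrite mulrAC ler_pdivlMr ?exprn_gt0// mulrC -/y; lra.
have -> : 2 * V / (lambda ^+ 2 * eta ^+ 2) * expR (- cx * s) =
    (2 / lambda ^+ 2) * expR (- cx * s) * (V / eta ^+ 2).
  by field; rewrite !gt_eqF.
have -> : N%:R * (V / (eta * expR (lambda * s)) ^+ 2) =
    N%:R / expR (lambda * s) ^+ 2 * (V / eta ^+ 2).
  by field; rewrite !gt_eqF.
rewrite ler_wpM2r ?divr_ge0 ?sqr_ge0// ler_pdivrMr ?exprn_gt0//.
apply: le_trans hN _; rewrite -[leRHS]mulrA ler_wpM2l ?divr_ge0 ?sqr_ge0//.
by rewrite -expRM_natl -expRD ler_expR; nra.
Qed.

Lemma precsim_ln (R : realType) (f tau : nat -> R) (K : nat) (p lambda eta alpha W : R) :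
  0 < p -> 0 < eta -> 0 < lambda -> 0 < alpha -> 0 <= W ->
  (forall q N, (K <= q)%N -> (0 < q)%N ->
    f N <= expR (- p * (N %/ q)%:R) + N%:R * tau q) ->
  (forall q, tau q <= W / expR ((eta * expR (lambda * q%:R)) `^ alpha)) ->
  exists cx, 0 < cx /\ precsim f (fun N => expR (- cx * N%:R / ln N%:R)).
Proof.
move=> p0 eta0 lambda0 alpha0 W0 hf htau.
pose kappa := 2 / (alpha * lambda).
have kappa0 : 0 < kappa by rewrite divr_gt0// mulr_gt0.
have kappa1 : 0 < kappa + 1 by rewrite addr_gt0.
exists (Num.min 1 (p / (kappa + 1))); rewrite lt_min ltr01 divr_gt0//.
split=> //; set cx := Num.min _ _.
have cx1 : cx <= 1 by rewrite ge_min lexx.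
have cxp : cx <= p / (kappa + 1) by rewrite ge_min lexx orbT.
pose h := eta `^ alpha; have h0 : 0 < h by exact: powR_gt0.
pose N0 := maxn (Num.truncn (expR (1 + K%:R / kappa))).+1 (Num.truncn (2 / h)).+1.
apply: (@precsim_bounded _ _ _ (expR p + W) N0) => [N|N]; first exact: expR_gt0.
rewrite geq_max => /andP[N1 N2].
have {}N1 : expR (1 + K%:R / kappa) <= N%:R.
  by apply: le_trans (ltW (truncnS_gt _)) _; rewrite ler_nat.
have {}N2 : 2 <= h * N%:R.
  rewrite mulrC -ler_pdivrMr//; apply: le_trans (ltW (truncnS_gt _)) _.
  by rewrite ler_nat.
have Npos : 0 < N%:R :> R by apply: lt_le_trans N1; exact: expR_gt0.
set l := ln _.
have lE : expR l = N%:R by exact: lnK.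
have hl : 1 + K%:R / kappa <= l by rewrite -ler_expR lE.
have l1 : 1 <= l by apply: le_trans hl; rewrite lerDl divr_ge0// ltW.
have l0 : 0 < l by exact: lt_le_trans l1.
set q := (Num.truncn (kappa * l)).+1.
have lq : kappa * l < q%:R by exact: truncnS_gt.
have ql : q%:R <= (kappa + 1) * l.
  rewrite -natr1 mulrDl mul1r; apply: lerD => //.
  by rewrite truncn_le mulr_ge0// ltW.
have Kq : (K <= q)%N.
  rewrite -(ler_nat R); apply: le_trans (ltW lq).
  have : K%:R / kappa <= l by lra.
  by rewrite ler_pdivrMr// mulrC.
have Nl : N%:R / l <= N%:R by rewrite ler_pdivrMr// ler_peMr// ltW.
have Nl0 : 0 <= N%:R / l by rewrite divr_ge0// ltW.
rewrite -mulrA; apply: le_trans (hf q N Kq isT) _; rewrite mulrDl; apply: lerD.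
  have := divn_add1_gt N (isT : (0 < q)%N) ql.
  rewrite invfM mulrCA -expRD ler_expR; set m := (_ %/ _)%N; set y := _ / l => hm.
  have : cx * y <= p / (kappa + 1) * y by rewrite ler_wpM2r.
  have : p * ((kappa + 1)^-1 * y) <= p * (m%:R + 1) by rewrite ler_wpM2l ?ltW.
  by rewrite mulrA mulrDr mulr1 !mulNr; lra.
apply: (@le_trans _ _ (N%:R * (W / expR (h * N%:R ^+ 2)))).
  rewrite ler_wpM2l//; apply: le_trans (htau q) _; rewrite ler_wpM2l// lef_pV2 ?posrE;
    rewrite ?expR_gt0// ler_expR powRM ?(ltW eta0) ?expR_ge0// ler_wpM2l ?ltW//.
  rewrite -lE -expRM_natl -expRM ltr_expR.
  have -> : 2 * l = (alpha * lambda) * (kappa * l).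
    by rewrite /kappa; field; rewrite !gt_eqF.
  by rewrite [ltRHS]mulrAC (mulrC lambda) ltr_pM2l// mulr_gt0.
rewrite mulrCA ler_wpM2l// ler_pdivrMr ?expR_gt0// -expRD.
apply: le_trans (_ : expR N%:R <= _).
  by apply: le_trans (expR_ge1Dx _); rewrite lerDr.
rewrite ler_expR.
have : cx * (N%:R / l) <= 1 * N%:R by apply: ler_pM; rewrite // le_min ler01 divr_ge0// ltW.
have : 2 * N%:R <= h * N%:R ^+ 2 by rewrite expr2 mulrA ler_wpM2r.
by rewrite mulNr; lra.
Qed.

Theorem mainTheorem5 (d : measure_display) (T : measurableType d) (R : realType)
  (P : probability T R) (c : nat -> R) (C lambda delta : R)
  (Y : nat -> {mfun T >-> R}) :
  c 0%N = 1 ->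
  (\sum_(k <oo) (`|c k|)%:E < +oo)%E ->
  0 < C -> 0 < lambda ->
  (forall q : nat, (1 <= q)%N ->
     (\sum_(q <= k <oo) (`|c k|)%:E <= (C * expR (- lambda * q%:R))%:E)%E) ->
  mutually_independent_pos P (fun n => Y n : T -> R) ->
  identically_distributed_pos P (fun n => Y n : T -> R) ->
  (\int[P]_w (((Y 1%N w) ^+ 2)%R)%:E < +oo)%E ->
  0 < delta ->
  (0 < P [set w | (Y 1%N w < - delta)%R])%E ->
  (0 < P [set w | (Y 1%N w > delta)%R])%E ->
  let A := fine (\sum_(k <oo) (`|c k|)%:E)%E in
  (forall x : R, 0 <= x -> x < delta * A ->
     exists cx : R, 0 < cx /\
       precsim (pN P c (fun n => Y n : T -> R) x)
               (fun N => expR (- cx * Num.sqrt N%:R))) /\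
  ((exists alpha : R, 0 < alpha /\
      (\int[P]_w ((expR (`|Y 1%N w| `^ alpha))%R)%:E < +oo)%E) ->
   forall x : R, 0 <= x -> x < delta * A ->
     exists cx : R, 0 < cx /\
       precsim (pN P c (fun n => Y n : T -> R) x)
               (fun N => expR (- cx * N%:R / ln N%:R))).
Proof.
move=> _ cfin C0 lambda0 ctail indep ident Y2fin delta0 Pneg Ppos A.
split=> [x _ xA|[alpha [alpha0 Yexp]] x _ xA];
  have [K [p [eta [p0 eta0 hpN]]]] := pN_le_block cfin C0 lambda0 ctail indep ident Y2fin
    delta0 Pneg Ppos xA.
- apply: (precsim_sqrt p0 eta0 lambda0 _ hpN); last first.
    by move=> q; apply: prob_norm_gt_sqr => //; rewrite mulr_gt0 ?expR_gt0.
  by rewrite fine_ge0//; apply: integral_ge0 => w _; rewrite lee_fin sqr_ge0.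
- apply: (precsim_ln p0 eta0 lambda0 alpha0 _ hpN); last first.
    by move=> q; apply: prob_norm_gt_expR => //; rewrite mulr_gt0 ?expR_gt0.
  by rewrite fine_ge0//; apply: integral_ge0 => w _; rewrite lee_fin expR_ge0.
Qed.
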